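(* Let $A=\sigma(R)\langle x_1,\dots,x_n\rangle$ be a bijective skew PBW extension of a ring $R$. Let $M={}_A\langle \mathbf{f}_1,\dots,\mathbf{f}_s\rangle$ be a finitely generated left $A$-submodule of $A^m$ and let $N={}_A\langle \mathbf{g}_1,\dots,\mathbf{g}_t\rangle_A$ be a finitely generated centralizing $A$-subbimodule of $A^l$, with $\mathbf{g}_j\in Cen_A(N)$ for $1\le j\le t$. Let $\Delta_M\in M_{s\times s_1}(A)$ and $\Delta_N\in M_{t\times t_1}(A)$ be matrices whose columns generate, as left $A$-modules, $Syz(M)\subseteq A^s$ and $Syz(N)\subseteq A^t$ respectively. Let $U$ be the matrix whose columns are the first $st$ coordinates of a system of generators of the right $A$-module $$Syz^r\big([\,(\Delta_M\otimes I_t)^T\mid I_{s_1}\otimes\Delta_N\,]\big).$$ Then there is an isomorphism of right $A$-modules $$Hom_A(M,N)\cong \langle U\rangle_A/\langle I_s\otimes\Delta_N\rangle_A,$$ and hence a presentation of $\langle U\rangle_A/\langle I_s\otimes\Delta_N\rangle_A$ is a presentation of $Hom_A(M,N)$.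
   Context: Skew PBW extension: given rings $R\subseteq A$, $A$ is a skew PBW extension of $R$, written $A=\sigma(R)\langle x_1,\dots,x_n\rangle$, if there are $x_1,\dots,x_n\in A$ such that $A$ is a free left $R$-module with basis $\{x_1^{\alpha_1}\cdots x_n^{\alpha_n}\mid \alpha\in\mathbb{N}^n\}$; for every $1\le i\le n$ and $r\in R\setminus\{0\}$ there is $c_{i,r}\in R\setminus\{0\}$ with $x_ir-c_{i,r}x_i\in R$; and for every $1\le i,j\le n$ there is $c_{i,j}\in R\setminus\{0\}$ with $x_jx_i-c_{i,j}x_ix_j\in R+Rx_1+\cdots+Rx_n$. Then for each $i$ there are an injective ring endomorphism $\sigma_i$ of $R$ and a $\sigma_i$-derivation $\delta_i$ of $R$ with $x_ir=\sigma_i(r)x_i+\delta_i(r)$ for all $r\in R$. $A$ is bijective if every $\sigma_i$ is bijective and $c_{i,j}$ is invertible for all $1\le i<j\le n$. $A$ is left and right Noetherian, so left and right submodules of $A^m$ are finitely generated. $A^m$ is the free module of column vectors of length $m$. ${}_A\langle X\rangle$, $\langle X\rangle_A$, ${}_A\langle X\rangle_A$ denote the left $A$-module, right $A$-module and $A$-bimodule generated by $X$; for a matrix $X$ it is the module generated by its columns. For an $A$-bimodule $N$, $Cen_A(N)=\{\mathbf{g}\in N\mid \mathbf{g}a=a\mathbf{g}\text{ for all }a\in A\}$; $N$ is a finitely generated centralizing bimodule if it is generated (as a left, equivalently right, $A$-module) by a finite subset of $Cen_A(N)$. $Syz(M)=\{(a_1,\dots,a_s)^T\in A^s\mid a_1\mathbf{f}_1+\cdots+a_s\mathbf{f}_s=0\}$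 is the left module of syzygies of the generators of $M$, and $Syz(N)\subseteq A^t$ is defined likewise from $\mathbf{g}_1,\dots,\mathbf{g}_t$. For a matrix $F\in M_{p\times q}(A)$, the right module of syzygies is $Syz^r(F)=\{\mathbf{a}\in A^q\mid F\mathbf{a}=0\}$, a right $A$-submodule of $A^q$. For matrices, $\otimes$ is the Kronecker product: $B\otimes C$ is the block matrix with blocks $b_{ij}C$. $I_k$ is the identity matrix of size $k$. $Hom_A(M,N)$ is the group of left $A$-module homomorphisms $M\to N$, a right $A$-module via the right $A$-module structure of the bimodule $N$.
   Formalization: The columns of Δ_N are assumed to generate Syz(N) as a right A-module as well as a left one; with left generation alone the claim fails (e.g. over the first Weyl algebra). *)

(* Defs.v *)
From HB Require Import structures.
From mathcomp Require Import all_boot all_order all_algebra.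
From mathcomp Require Import boolp.
From mathcomp Require Import ring_quotient mxtens.

Set Implicit Arguments.
Unset Strict Implicit.
Unset Printing Implicit Defensive.

Import GRing.Theory.
Local Open Scope ring_scope.

(* The inclusion R ⊆ A is an injective ring morphism [iota : R -> A], and a
   right A-module is a left module over the converse ring A^c. *)

Section SkewPBW.
Variables (R A : nzRingType) (iota : {rmorphism R -> A}).
Variables (n : nat) (x : 'I_n -> A).

(* The factors are multiplied in increasing order of their indices. *)
Definition pbw_monomial (alpha : {ffun 'I_n -> nat}) : A :=
  \prod_(i < n) x i ^+ alpha i.

Definition pbw_comb (s : seq {ffun 'I_n -> nat})
    (c : {ffun 'I_n -> nat} -> R) : A :=
  \sum_(alpha <- s) iota (c alpha) * pbw_monomial alpha.

Definition pbw_basis : Prop :=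
  (forall a : A, exists s c, a = pbw_comb s c) /\
  (forall s c, uniq s -> pbw_comb s c = 0 -> {in s, forall alpha, c alpha = 0}).

(* x_j x_i - c x_i x_j belongs to R + R x_1 + ... + R x_n. *)
Definition pbw_comm (i j : 'I_n) (c : R) : Prop :=
  exists (d0 : R) (d : 'I_n -> R),
    x j * x i - iota c * x i * x j = iota d0 + \sum_(k < n) iota (d k) * x k.

Record skew_PBW : Prop := SkewPBW {
  pbw_sub : injective iota;
  pbw_free : pbw_basis;
  pbw_coef : forall (i : 'I_n) (r : R), r != 0 ->
    exists c : R, c != 0 /\ exists d : R, x i * iota r - iota c * x i = iota d;
  pbw_var : forall i j : 'I_n, exists c : R, c != 0 /\ pbw_comm i j c
}.

Definition skew_derivation (sigma : R -> R) (delta : R -> R) : Prop :=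
  (forall r s, delta (r + s) = delta r + delta s) /\
  (forall r s, delta (r * s) = sigma r * delta s + delta r * s).

Definition invertible (c : R) : Prop := exists d : R, c * d = 1 /\ d * c = 1.

(* By freeness, sigma_i, delta_i, and c_{i,j} for i < j, are uniquely
   determined by their defining equations. *)
Record bijective_skew_PBW : Prop := BijectiveSkewPBW {
  bpbw_skew : skew_PBW;
  bpbw_sigma : forall i : 'I_n,
    exists (sigma : {rmorphism R -> R}) (delta : R -> R),
      [/\ skew_derivation sigma delta,
          forall r, x i * iota r = iota (sigma r) * x i + iota (delta r)
        & bijective sigma];
  bpbw_unit : forall i j : 'I_n, (i < j)%N ->
    exists c : R, invertible c /\ pbw_comm i j c
}.

End SkewPBW.

Section Span.
Variables (K : nzRingType) (V : lmodType K) (p : nat) (X : 'I_p -> V).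

Definition lspan : {pred V} :=
  fun v => `[< exists c : 'I_p -> K, v = \sum_(i < p) c i *: X i >].

Lemma lspan_submod_closed : submod_closed lspan.
Proof.
split; first by apply/asboolP; exists (fun=> 0);
  rewrite big1 // => i _; rewrite scale0r.
move=> a u v /asboolP[c ->] /asboolP[d ->]; apply/asboolP.
exists (fun i => a * c i + d i); rewrite scaler_sumr -big_split /=.
by apply: eq_bigr => i _; rewrite scalerDl scalerA.
Qed.

HB.instance Definition _ :=
  GRing.isSubmodClosed.Build K V lspan lspan_submod_closed.

Record submod : Type := Submod { submod_val :> V; _ : submod_val \in lspan }.
HB.instance Definition _ := [isSub for submod_val].
HB.instance Definition _ := [Choice of submod by <:].
HB.instance Definition _ := [SubChoice_isSubLmodule of submod by <:].

Definition syz : {pred 'cV[K]_p} :=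
  fun a => \sum_(i < p) a i ord0 *: X i == 0.

End Span.

Section ModuleQuotient.
Variables (K : nzRingType) (V : lmodType K) (Q : submodClosed V).
Local Open Scope quotient_scope.

(* [submodClosed] does not record closure under opposites, which
   [Quotient.quot] asks for. *)
Definition zmod_pred : {pred V} := fun v => v \in Q.

Lemma zmod_pred_closed : zmod_closed zmod_pred.
Proof.
split=> [|u v Qu Qv]; first exact: (rpred0 Q).
by have /(rpredD Qu) : -1 *: v \in Q; [apply: rpredZ | rewrite scaleN1r].
Qed.

HB.instance Definition _ := GRing.isZmodClosed.Build V zmod_pred zmod_pred_closed.

Definition modquot : Type := Quotient.quot zmod_pred.
HB.instance Definition _ := GRing.Zmodule.on modquot.

Definition modquot_pi (u : V) : modquot := \pi_(Quotient.quot zmod_pred) u.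
Definition modquot_repr (y : modquot) : V := repr (y : Quotient.quot zmod_pred).

Lemma modquot_reprK : cancel modquot_repr modquot_pi.
Proof. exact: reprK. Qed.

Lemma modquot_piP u v : reflect (modquot_pi u = modquot_pi v) (u - v \in Q).
Proof.
apply: (iffP idP) => [Quv | /eqP]; last by rewrite -(Quotient.idealrBE zmod_pred).
by apply/eqP; rewrite -(Quotient.idealrBE zmod_pred).
Qed.

Definition modquot_scale (a : K) (y : modquot) : modquot :=
  modquot_pi (a *: modquot_repr y).

Lemma modquot_scale_pi a u :
  modquot_scale a (modquot_pi u) = modquot_pi (a *: u).
Proof.
apply/modquot_piP; rewrite -scalerBr rpredZ //.
by apply/modquot_piP; rewrite modquot_reprK.
Qed.

Lemma modquot_piD u v : modquot_pi (u + v) = modquot_pi u + modquot_pi v.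
Proof. exact: (Quotient.pi_add zmod_pred). Qed.

Lemma modquot_scaleA a b y :
  modquot_scale a (modquot_scale b y) = modquot_scale (a * b) y.
Proof. by rewrite -[y]modquot_reprK !modquot_scale_pi scalerA. Qed.

Lemma modquot_scale1 : left_id 1 modquot_scale.
Proof. by move=> y; rewrite -[y]modquot_reprK modquot_scale_pi scale1r. Qed.

Lemma modquot_scaleDr : right_distributive modquot_scale +%R.
Proof.
move=> a y z; rewrite -[y]modquot_reprK -[z]modquot_reprK.
by rewrite -modquot_piD !modquot_scale_pi scalerDr modquot_piD.
Qed.

Lemma modquot_scaleDl y : {morph modquot_scale^~ y : a b / a + b}.
Proof.
move=> a b; rewrite -[y]modquot_reprK !modquot_scale_pi scalerDl.
exact: modquot_piD.
Qed.

HB.instance Definition _ := GRing.Zmodule_isLmodule.Build K modquot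
  modquot_scaleA modquot_scale1 modquot_scaleDr modquot_scaleDl.

End ModuleQuotient.

Section SubQuotient.
Variables (K : nzRingType) (V : lmodType K) (p q : nat).
Variables (X : 'I_p -> V) (Y : 'I_q -> V).

Definition restr_span : {pred submod X} := fun v => val v \in lspan Y.

Lemma restr_span_submod_closed : submod_closed restr_span.
Proof.
split=> [|a u v Yu Yv]; first by rewrite -[_ \in _]/(val 0 \in _) raddf0 rpred0.
rewrite -[_ \in _]/(val (a *: u + v) \in _) linearP.
by apply: rpredD => //; apply: rpredZ.
Qed.

HB.instance Definition _ := GRing.isSubmodClosed.Build K (submod X)
  restr_span restr_span_submod_closed.

(* <X> / (<X> ∩ <Y>), which is <X> / <Y> whenever <Y> is contained in <X>. *)
Definition subquo : Type := modquot restr_span.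
HB.instance Definition _ := GRing.Lmodule.on subquo.

End SubQuotient.

Definition lmod_iso (K : nzRingType) (V W : lmodType K) : Prop :=
  exists f : {linear V -> W}, bijective f.

Definition noetherian (K : nzRingType) : Prop :=
  forall I : {pred K^o}, submod_closed I ->
    exists (p : nat) (X : 'I_p -> K^o), I =i lspan X.

Section Columns.
Variables (A : nzRingType) (p q : nat) (D : 'M[A]_(p, q)).

(* On 'cV[A^c]_p, scaling by a is right multiplication of the entries by a. *)
Definition rcols (j : 'I_q) : 'cV[A^c]_p := col j D.

Definition lcolspan : {pred 'cV[A]_p} := lspan (fun j => col j D).
Definition rcolspan : {pred 'cV[A^c]_p} := lspan rcols.

Definition syzr : {pred 'cV[A]_q} := fun a => D *m a == 0.

(* The right module A^p / <D>_A. *)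
Definition rcoker : Type := modquot (lspan rcols).
HB.instance Definition _ := GRing.Lmodule.on rcoker.

Definition is_presentation (P : lmodType A^c) : Prop := lmod_iso rcoker P.

End Columns.

Section Bimodule.
Variables (A : nzRingType) (l : nat).

Definition rmul (v : 'cV[A]_l) (a : A) : 'cV[A]_l := map_mx ( *%R^~ a) v.

Definition central_in (N : {pred 'cV[A]_l}) : {pred 'cV[A]_l} :=
  fun v => (v \in N) && `[< forall a : A, rmul v a = a *: v >].

Variables (t : nat) (g : 'I_t -> 'cV[A]_l).

Definition bispan : {pred 'cV[A]_l} :=
  fun v => `[< exists s : seq (A * 'I_t * A),
    v = \sum_(z <- s) z.1.1 *: rmul (g z.1.2) z.2 >].

Lemma rmulD u v a : rmul (u + v) a = rmul u a + rmul v a.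
Proof. by apply/matrixP=> i j; rewrite !mxE mulrDl. Qed.

Lemma rmulZ b v a : rmul (b *: v) a = b *: rmul v a.
Proof. by apply/matrixP=> i j; rewrite !mxE mulrA. Qed.

Lemma rmulA v a b : rmul (rmul v a) b = rmul v (a * b).
Proof. by apply/matrixP=> i j; rewrite !mxE mulrA. Qed.

Lemma rmul1 v : rmul v 1 = v.
Proof. by apply/matrixP=> i j; rewrite !mxE mulr1. Qed.

Lemma rmulDr v a b : rmul v (a + b) = rmul v a + rmul v b.
Proof. by apply/matrixP=> i j; rewrite !mxE mulrDr. Qed.

Lemma bispan_submod_closed : submod_closed bispan.
Proof.
split; first by apply/asboolP; exists [::]; rewrite big_nil.
move=> a u v /asboolP[s ->] /asboolP[s' ->]; apply/asboolP.
exists ([seq (a * z.1.1, z.1.2, z.2) | z <- s] ++ s').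
rewrite big_cat big_map scaler_sumr; congr (_ + _).
by apply: eq_bigr => z _ /=; rewrite scalerA.
Qed.

HB.instance Definition _ :=
  GRing.isSubmodClosed.Build A 'cV[A]_l bispan bispan_submod_closed.

Lemma bispan_rmul v a : v \in bispan -> rmul v a \in bispan.
Proof.
move=> /asboolP[s ->]; apply/asboolP.
exists [seq (z.1.1, z.1.2, z.2 * a) | z <- s]; rewrite big_map.
elim: s => [|z s IHs].
  by rewrite !big_nil; apply/matrixP=> i j; rewrite !mxE mul0r.
by rewrite !big_cons rmulD rmulZ rmulA IHs.
Qed.

(* [bimod] carries the left structure; [bimod_rmul] is the right one. *)
Record bimod : Type := Bimod { bimod_val :> 'cV[A]_l; _ : bimod_val \in bispan }.
HB.instance Definition _ := [isSub for bimod_val].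
HB.instance Definition _ := [Choice of bimod by <:].
HB.instance Definition _ := [SubChoice_isSubLmodule of bimod by <:].

Definition bimod_rmul (v : bimod) (a : A) : bimod :=
  Bimod (bispan_rmul a (valP v)).

End Bimodule.

Section Hom.
Variables (A : nzRingType) (M : lmodType A) (l t : nat) (g : 'I_t -> 'cV[A]_l).
Local Notation N := (bimod g).

Definition homlr : Type := {linear M -> N}.
HB.instance Definition _ := gen_eqMixin homlr.
HB.instance Definition _ := gen_choiceMixin homlr.

Implicit Types h k : homlr.

Definition hom_fun (h : homlr) : M -> N := h : {linear M -> N}.
Coercion hom_fun : homlr >-> Funclass.

Lemma homlr_ext h k : h =1 k -> h = k.
Proof.
case: h k => [h Ch] [k Ck] /funext; rewrite /hom_fun /= => E.
have {}E : h = k := E; subst k; congr GRing.Linear.Pack.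
destruct Ch as [[c1] [c2]], Ck as [[d1] [d2]].
by rewrite (Prop_irrelevance c1 d1) (Prop_irrelevance c2 d2).
Qed.

Definition homlr_zero : homlr := (\0 : {linear M -> N}).
Definition homlr_opp h : homlr := (\- (h : {linear M -> N}) : {linear M -> N}).
Definition homlr_add h k : homlr :=
  ((h : {linear M -> N}) \+ (k : {linear M -> N}) : {linear M -> N}).

Lemma homlr_addA : associative homlr_add.
Proof. by move=> h1 h2 h3; apply: homlr_ext => v; apply: addrA. Qed.

Lemma homlr_addC : commutative homlr_add.
Proof. by move=> h k; apply: homlr_ext => v; apply: addrC. Qed.

Lemma homlr_add0 : left_id homlr_zero homlr_add.
Proof. by move=> h; apply: homlr_ext => v; apply: add0r. Qed.

Lemma homlr_addN : left_inverse homlr_zero homlr_opp homlr_add.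
Proof. by move=> h; apply: homlr_ext => v; apply: addNr. Qed.

HB.instance Definition _ := GRing.isZmodule.Build homlr
  homlr_addA homlr_addC homlr_add0 homlr_addN.

Definition homlr_rmul_fun (a : A) h (v : M) : N := bimod_rmul (h v) a.

Lemma homlr_rmul_linear a h : linear (homlr_rmul_fun a h).
Proof.
move=> b u v; have huv : h (b *: u + v) = b *: h u + h v by apply: linearP.
apply: val_inj; rewrite /= huv.
by apply: etrans (rmulD _ _ _) _; rewrite rmulZ.
Qed.

HB.instance Definition _ a h :=
  GRing.isLinear.Build A M N _ (homlr_rmul_fun a h) (homlr_rmul_linear a h).

Definition homlr_rmul (a : A^c) h : homlr :=
  (homlr_rmul_fun a h : {linear M -> N}).

Lemma homlr_rmulA a b h :
  homlr_rmul a (homlr_rmul b h) = homlr_rmul (a * b) h.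
Proof. by apply: homlr_ext => v; apply: val_inj; apply: rmulA. Qed.

Lemma homlr_rmul1 : left_id 1 homlr_rmul.
Proof. by move=> h; apply: homlr_ext => v; apply: val_inj; apply: rmul1. Qed.

Lemma homlr_rmulDr : right_distributive homlr_rmul +%R.
Proof. by move=> a h k; apply: homlr_ext => v; apply: val_inj; apply: rmulD. Qed.

Lemma homlr_rmulDl h : {morph homlr_rmul^~ h : a b / a + b}.
Proof. by move=> a b; apply: homlr_ext => v; apply: val_inj; apply: rmulDr. Qed.

HB.instance Definition _ := GRing.Zmodule_isLmodule.Build A^c homlr
  homlr_rmulA homlr_rmul1 homlr_rmulDr homlr_rmulDl.

End Hom.

(* Main.v *)
(* Since the g_k are central, every element of N is a left combination of them,
   so a homomorphism h : M -> N is recorded by a vector (a_ik) of A^(st) with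
   h(f_i) = \sum_k a_ik g_k. Such a vector defines a homomorphism exactly when it
   respects the relations DM, i.e. when every \sum_i DM_ij a_i lies in Syz(N);
   this says that it is the upper part of an element of
   Syz^r([(DM (x) I_t)^T | I_(s1) (x) DN]), i.e. that it lies in <U>_A. It defines
   the zero homomorphism exactly when each a_i lies in Syz(N), i.e. when it lies
   in <I_s (x) DN>_A. Centrality also makes the correspondence right linear. *)

From HB Require Import structures.
Require Import Defs.
From mathcomp Require Import all_boot all_order all_algebra.
From mathcomp Require Import boolp mxtens.
Set Implicit Arguments.
Unset Strict Implicit.
Unset Printing Implicit Defensive.

Import GRing.Theory.
Local Open Scope ring_scope.

(** * Isomorphisms of modules induced by linear relations *)

Section LmodIso.
Variable K : nzRingType.

Lemma lmod_iso_sym (V W : lmodType K) : lmod_iso V W -> lmod_iso W V.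
Proof.
case=> f [f' fK f'K].
pose L := GRing.isLinear.Build K W V _ f' (can2_linear fK f'K).
pose g : {linear W -> V} := HB.pack f' L.
by exists g, f.
Qed.

Lemma lmod_iso_trans (V W Z : lmodType K) :
  lmod_iso V W -> lmod_iso W Z -> lmod_iso V Z.
Proof. by case=> f bf [g bg]; exists (g \o f); apply: bij_comp. Qed.

(** First isomorphism theorem: the relation is the graph of a linear surjection from [V] onto [W]
    with kernel [Q]. The map is built from [W] to the quotient, by choosing preimages. *)
Lemma lmod_iso_rel (V W : lmodType K) (Q : submodClosed V)
    (P : V -> W -> Prop) :
    (forall c v v' w w', P v w -> P v' w' -> P (c *: v + v') (c *: w + w')) ->
    (forall v, exists w, P v w) -> (forall w, exists v, P v w) ->
    (forall v, P v 0 <-> v \in Q) ->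
    (forall v w w', P v w -> P v w' -> w = w') ->
  lmod_iso W (modquot Q).
Proof.
move=> Plin Ptot Psurj PQ Pfun.
pose lift w := projT1 (cid (Psurj w)).
have liftP w : P (lift w) w by rewrite /lift; case: cid.
(* Two preimages of [w] differ by a preimage of 0, so the choice made by [lift] does not matter
   modulo [Q]. *)
have piP v w : P v w -> modquot_pi Q (lift w) = modquot_pi Q v.
  move=> Pvw; apply/modquot_piP/PQ.
  by have := Plin (-1) _ _ _ _ Pvw (liftP w); rewrite !scaleN1r addNr addrC.
pose F w : modquot Q := modquot_pi Q (lift w).
have linF : linear F.
  move=> c w w'; rewrite /F (piP _ _ (Plin c _ _ _ _ (liftP w) (liftP w'))).
  by rewrite modquot_piD -modquot_scale_pi.
pose L := GRing.isLinear.Build K W (modquot Q) _ F linF.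
pose f : {linear W -> modquot Q} := HB.pack F L.
pose val_of v := projT1 (cid (Ptot v)).
have valP v : P v (val_of v) by rewrite /val_of; case: cid.
exists f, (fun y => val_of (modquot_repr y)) => [w | y] /=.
  have Pw := valP (modquot_repr (F w)); set v := modquot_repr _ in Pw *.
  have /modquot_piP/PQ P0 : modquot_pi Q v = modquot_pi Q (lift w).
    exact: modquot_reprK.
  apply: (Pfun v) => //.
  by have := Plin 1 _ _ _ _ P0 (liftP w); rewrite !scale1r subrK add0r.
by rewrite /F (piP _ _ (valP _)) modquot_reprK.
Qed.

End LmodIso.

Lemma sum_delta (K : nzRingType) (V : lmodType K) (p : nat) (X : 'I_p -> V) i :
  \sum_j (j == i)%:R *: X j = X i.
Proof.
rewrite (bigD1 i) //= eqxx scale1r big1 ?addr0 // => j /negPf->.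
by rewrite scale0r.
Qed.

(** * Finitely generated submodules and linear maps out of them *)

Section Span.
Variables (K : nzRingType) (V : lmodType K) (p : nat) (X : 'I_p -> V).

Lemma lspanP v :
  reflect (exists c : 'I_p -> K, v = \sum_(i < p) c i *: X i) (v \in lspan X).
Proof. exact: asboolP. Qed.

Lemma lspan_gen i : X i \in lspan X.
Proof.
by apply/lspanP; exists (fun j => (j == i)%:R); rewrite sum_delta.
Qed.

Definition submod_gen i : submod X := Submod (lspan_gen i).

Lemma submod_comb (v : submod X) :
  exists c : 'I_p -> K, v = \sum_(i < p) c i *: submod_gen i.
Proof.
have /lspanP[c vE] := valP v; exists c; apply: val_inj; rewrite [LHS]vE.
by rewrite raddf_sum; apply: eq_bigr.
Qed.

(** Coefficients of each element are chosen arbitrarily; two choices differ by a syzygy of [X],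
    which [y] also satisfies, so the image is independent of the choice. *)
Lemma submod_extend (N : lmodType K) (y : 'I_p -> N) :
    (forall c : 'I_p -> K, \sum_i c i *: X i = 0 -> \sum_i c i *: y i = 0) ->
  exists h : {linear submod X -> N}, forall i, h (submod_gen i) = y i.
Proof.
move=> Hy.
have Hy2 (c d : 'I_p -> K) : \sum_i c i *: X i = \sum_i d i *: X i ->
    \sum_i c i *: y i = \sum_i d i *: y i.
  move=> E; apply/eqP; rewrite -subr_eq0 -sumrB; apply/eqP.
  under eq_bigr do rewrite -scalerBl.
  apply: Hy; under eq_bigr do rewrite scalerBl.
  by rewrite sumrB E subrr.
pose coef (v : submod X) := projT1 (cid (lspanP _ (valP v))).
have coefP v : val v = \sum_i coef v i *: X i by rewrite /coef; case: cid.
pose F v := \sum_i coef v i *: y i.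
have linF : linear F.
  move=> a u v; rewrite /F scaler_sumr -big_split /=.
  under [RHS]eq_bigr do rewrite scalerA -scalerDl.
  apply: Hy2; rewrite -coefP linearP /= !coefP scaler_sumr -big_split /=.
  by apply: eq_bigr => i _; rewrite scalerDl scalerA.
pose L := GRing.isLinear.Build K (submod X) N _ F linF.
pose h : {linear submod X -> N} := HB.pack F L.
exists h => i; transitivity (\sum_j ((j == i)%:R : K) *: y j); last exact: sum_delta.
by apply: Hy2; rewrite -coefP sum_delta.
Qed.

End Span.

(** * Right column spans and the block action of Kronecker products *)

Section Blocks.
Variable A : nzRingType.

Lemma rcolspanP (p q : nat) (D : 'M[A]_(p, q)) (v : 'cV[A]_p) :
  (exists b : 'cV[A]_q, v = D *m b) <-> v \in rcolspan D.
Proof.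
have sumE (c : 'I_q -> A^c) :
    \sum_j c j *: rcols D j = D *m (\col_j c j : 'cV[A]_q).
  apply/matrixP => i k; rewrite summxE [RHS]mxE; apply: eq_bigr => j _.
  by rewrite !mxE.
split=> [[b ->] | /lspanP[c ->]]; last by exists (\col_j c j).
apply/lspanP; exists (fun j => b j ord0); rewrite sumE.
apply: (congr1 (mulmx D)).
by apply/matrixP => j k; rewrite mxE ord1.
Qed.

Definition tensblock (p r : nat) (a : 'cV[A]_(p * r)) (i : 'I_p) : 'cV[A]_r :=
  \col_k a (mxtens_index (i, k)) ord0.

Lemma tensblockP (p r : nat) (a b : 'cV[A]_(p * r)) :
  tensblock a =1 tensblock b -> a = b.
Proof.
move=> E; apply/matrixP => i j; rewrite ord1.
case: (mxtens_indexP i) => i1 i2.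
by have /matrixP/(_ i2 ord0) := E i1; rewrite !mxE.
Qed.

Lemma sum_mxtens_index (V : nmodType) (p r : nat) (F : 'I_(p * r) -> V) :
  \sum_i F i = \sum_(i < p) \sum_(k < r) F (mxtens_index (i, k)).
Proof.
rewrite pair_big /= (reindex (@mxtens_index p r)) /=; first by
  apply: eq_bigr => -[].
by exists (@mxtens_unindex p r) => i _; rewrite (mxtens_indexK, mxtens_unindexK).
Qed.

Lemma tensblock_tens1mx (p r q : nat) (D : 'M[A]_(r, q)) (b : 'cV[A]_(p * q)) i :
  tensblock (((1%:M : 'M[A]_p) *t D) *m b) i = D *m tensblock b i.
Proof.
apply/matrixP => k j; rewrite !mxE sum_mxtens_index (bigD1 i) //=.
rewrite [X in _ + X]big1 ?addr0 => [|i' ne].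
  by apply: eq_bigr => k' _; rewrite tensmxE !mxE eqxx mul1r.
by rewrite big1 // => k' _; rewrite tensmxE mxE eq_sym (negPf ne) !mul0r.
Qed.

(** Entries of the transpose stay left factors, so this matrix product forms left combinations of
    the blocks, as needed for left syzygies. *)
Lemma tensblock_tensmx1_tr (p r q : nat) (D : 'M[A]_(p, q))
    (a : 'cV[A]_(p * r)) j :
  tensblock ((D *t (1%:M : 'M[A]_r))^T *m a) j =
    \sum_i D i j *: tensblock a i.
Proof.
apply/matrixP => k z; rewrite summxE !mxE sum_mxtens_index; apply: eq_bigr => i _.
rewrite (bigD1 k) //= [X in _ + X]big1 ?addr0 => [|k' ne].
  by rewrite !mxE !mxtens_indexK /= eqxx mulr1.
by rewrite mxE tensmxE mxE (negPf ne) mulr0 mul0r.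
Qed.

Lemma rcolspan_tens1mx (p r q : nat) (D : 'M[A]_(r, q)) (a : 'cV[A]_(p * r)) :
  a \in rcolspan ((1%:M : 'M[A]_p) *t D) <->
  forall i, tensblock a i \in rcolspan D.
Proof.
split=> [/rcolspanP[b ->] i | H].
  by apply/rcolspanP; exists (tensblock b i); rewrite tensblock_tens1mx.
have bP i : exists b, tensblock a i = D *m b by apply/rcolspanP.
(* Stack the chosen preimages of the blocks. *)
pose b : 'cV[A]_(p * q) := \col_i
  projT1 (cid (bP (mxtens_unindex i).1)) (mxtens_unindex i).2 ord0.
apply/rcolspanP; exists b; apply: tensblockP => i; rewrite tensblock_tens1mx.
have -> : tensblock b i = projT1 (cid (bP i)).
  by apply/matrixP => k z; rewrite mxE mxE mxtens_indexK [z]ord1.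
by case: cid.
Qed.

(** A syzygy of [[L | D]] is a pair [(a, b)] with [L a = - D b]; forgetting [b] leaves a condition
    on [L a] alone. *)
Lemma rcolspan_usubmx (p p' q r : nat) (L : 'M[A]_(r, p)) (D : 'M[A]_(r, p'))
    (G : 'M[A]_(p + p', q)) (a : 'cV[A]_p) :
    syzr (row_mx L D) =i rcolspan G ->
  a \in rcolspan (usubmx G) <-> L *m a \in rcolspan D.
Proof.
move=> hG; split=> [/rcolspanP[b ->] | /rcolspanP[b Lab]].
  have : G *m b \in rcolspan G by apply/rcolspanP; exists b.
  rewrite -hG -[_ \in _]/(row_mx L D *m (G *m b) == 0) -{1}[G]vsubmxK mul_col_mx.
  rewrite mul_row_col addr_eq0 => /eqP ->.
  by apply/rcolspanP; exists (- (dsubmx G *m b)); rewrite mulmxN.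
have : col_mx a (- b) \in syzr (row_mx L D).
  by rewrite -[_ \in _]/(_ == 0) mul_row_col Lab mulmxN subrr.
rewrite hG => /rcolspanP[d abE]; apply/rcolspanP; exists d.
by rewrite mul_usub_mx -abE col_mxKu.
Qed.

End Blocks.

(** * Left combinations of central generators *)

Section CentralCombinations.
Variables (A : nzRingType) (l t : nat) (g : 'I_t -> 'cV[A]_l).

Definition gcomb (a : 'cV[A]_t) : 'cV[A]_l := \sum_k a k ord0 *: g k.

Lemma gcombP c a b : gcomb (c *: a + b) = c *: gcomb a + gcomb b.
Proof.
rewrite /gcomb scaler_sumr -big_split /=; apply: eq_bigr => k _.
by rewrite !mxE scalerDl scalerA.
Qed.

Lemma gcombD a b : gcomb (a + b) = gcomb a + gcomb b.
Proof. by have := gcombP 1 a b; rewrite !scale1r. Qed.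

Lemma gcomb0 : gcomb 0 = 0.
Proof. by rewrite /gcomb big1 // => k _; rewrite mxE scale0r. Qed.

Lemma gcomb_sum (p : nat) (c : 'I_p -> A) (a : 'I_p -> 'cV[A]_t) :
  gcomb (\sum_i c i *: a i) = \sum_i c i *: gcomb (a i).
Proof.
elim/big_rec2: _ => [|i y1 y2 _ <-]; first exact: gcomb0.
exact: gcombP.
Qed.

Hypothesis hg : forall j, g j \in central_in (bispan g).

Lemma rmul_gen a k : rmul (g k) a = a *: g k.
Proof. by have /andP[_ /asboolP] := hg k; apply. Qed.

(** Centrality moves [c] past each generator: [(a_k g_k) c = (a_k c) g_k]. *)
Lemma rmul_gcomb c a : rmul (gcomb a) c = gcomb (map_mx ( *%R^~ c) a).
Proof.
apply/matrixP => i j; rewrite !mxE !summxE mulr_suml; apply: eq_bigr => k _.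
have /matrixP/(_ i j) := rmul_gen c k.
by rewrite !mxE -!mulrA => ->.
Qed.

Lemma gcomb_bispan a : gcomb a \in bispan g.
Proof.
by apply: rpred_sum => k _; apply: rpredZ; have /andP[] := hg k.
Qed.

Lemma bispan_gcomb v : v \in bispan g -> exists a, v = gcomb a.
Proof.
case/asboolP=> z ->; elim: z => [|y z [a IH]].
  by exists 0; rewrite big_nil gcomb0.
(* By centrality, a term [b g_k c] equals [(b c) g_k]. *)
exists ((y.1.1 * y.2) *: (\col_k (k == y.1.2)%:R) + a).
rewrite big_cons gcombP -IH rmul_gen scalerA; congr (_ *: _ + _).
by rewrite /gcomb -[LHS]sum_delta; apply: eq_bigr => k _; rewrite mxE.
Qed.

End CentralCombinations.

(** * Coefficient vectors representing homomorphisms *)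

Section Representation.
Variables (A : nzRingType) (m s : nat) (f : 'I_s -> 'cV[A]_m).
Variables (l t : nat) (g : 'I_t -> 'cV[A]_l).
Hypothesis hg : forall j, g j \in central_in (bispan g).
Variables (s1 t1 : nat) (DM : 'M[A]_(s, s1)) (DN : 'M[A]_(t, t1)).
Hypotheses (hDM : syz f =i lcolspan DM) (hDN : syz g =i rcolspan DN).

Definition represents (a : 'cV[A]_(s * t)) (h : homlr (submod f) g) : Prop :=
  forall i, val (h (submod_gen f i)) = gcomb g (tensblock a i).

Lemma represents_comb a h (c : 'I_s -> A) : represents a h ->
  gcomb g (\sum_i c i *: tensblock a i) =
  val (h (\sum_i c i *: submod_gen f i)).
Proof.
move=> ha; rewrite gcomb_sum /hom_fun linear_sum raddf_sum.
by apply: eq_bigr => i _; rewrite linearZZ -ha.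
Qed.

Lemma represents_inj a h h' : represents a h -> represents a h' -> h = h'.
Proof.
move=> ha h'a; apply: homlr_ext => v; have [c ->] := submod_comb v.
by apply: val_inj; rewrite -!(represents_comb _ ha, represents_comb _ h'a).
Qed.

Lemma represents_ex h : exists a, represents a h.
Proof.
have aP i : exists a, val (h (submod_gen f i)) = gcomb g a.
  exact/(bispan_gcomb hg)/valP.
exists (\col_i projT1 (cid (aP (mxtens_unindex i).1)) (mxtens_unindex i).2 ord0).
move=> i; rewrite [LHS](projT2 (cid (aP i))); congr gcomb.
by apply/matrixP => k z; rewrite !mxE mxtens_indexK [z]ord1.
Qed.

Lemma represents_linear (c : A^c) (a a' : 'cV[A^c]_(s * t)) h h' :
  represents a h -> represents a' h' ->
  represents (c *: a + a' : 'cV[A^c]_(s * t)) (c *: h + h').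
Proof.
move=> ha h'a i.
have -> : val ((c *: h + h') (submod_gen f i)) =
  rmul (val (h (submod_gen f i))) c + val (h' (submod_gen f i)) by [].
rewrite ha h'a rmul_gcomb // -gcombD; congr gcomb.
by apply/matrixP => k z; rewrite !mxE.
Qed.

Lemma represents0 (a : 'cV[A]_(s * t)) :
  represents a 0 <-> a \in rcolspan ((1%:M : 'M[A]_s) *t DN).
Proof.
split=> [H | /rcolspan_tens1mx H i].
  apply/rcolspan_tens1mx => i; rewrite -hDN; apply/eqP.
  exact: esym (H i).
by apply/esym/eqP; move: (H i); rewrite -hDN.
Qed.

(* The membership says that the s1 vectors \sum_i DM i j *: tensblock a i are
   syzygies of g, i.e. that the prescribed images of the f i satisfy the
   relations DM. *)
Lemma represents_coef (a : 'cV[A]_(s * t)) :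
  (exists h, represents a h) <->
  (DM *t (1%:M : 'M[A]_t))^T *m a \in rcolspan ((1%:M : 'M[A]_s1) *t DN).
Proof.
split=> [[h ha] | /rcolspan_tens1mx H].
  apply/rcolspan_tens1mx => j; rewrite tensblock_tensmx1_tr -hDN; apply/eqP.
  rewrite -/(gcomb g _) (represents_comb _ ha).
  (* Column [j] of [DM] is a relation among the [f i]. *)
  have -> : \sum_i DM i j *: submod_gen f i = 0; last by rewrite /hom_fun raddf0.
  have : col j DM \in syz f by rewrite hDM; apply: lspan_gen.
  move=> /eqP colj; apply: val_inj; rewrite raddf_sum /= -[RHS]colj.
  by apply: eq_bigr => i _; rewrite mxE.
pose y i : bimod g := Bimod (gcomb_bispan hg (tensblock a i)).
have [c c0|h hE] := submod_extend (X := f) (y := y); last first.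
  by exists h => i; rewrite /hom_fun hE.
apply: val_inj; rewrite raddf_sum /=.
transitivity (gcomb g (\sum_i c i *: tensblock a i)); first by rewrite gcomb_sum.
(* A syzygy [c] of [f] is a left combination of the columns of [DM], so the combination of blocks
   with coefficients [c] is a left combination of the vectors that [H] places in Syz(N). *)
have : (\col_i c i) \in syz f.
  by apply/eqP; rewrite -[RHS]c0; apply: eq_bigr => i _; rewrite mxE.
rewrite hDM => /lspanP[e cE].
have -> : \sum_i c i *: tensblock a i =
    \sum_j e j *: \sum_i DM i j *: tensblock a i.
  under [RHS]eq_bigr do rewrite scaler_sumr.
  rewrite exchange_big; apply: eq_bigr => i _.
  have /matrixP/(_ i ord0) := cE; rewrite summxE mxE => ->.
  by rewrite scaler_suml; apply: eq_bigr => j _; rewrite !mxE scalerA.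
rewrite gcomb_sum big1 // => j _; move: (H j).
by rewrite tensblock_tensmx1_tr -hDN => /eqP e0; rewrite [gcomb _ _]e0 scaler0.
Qed.

End Representation.

(* Since the g j are central in N, Syz(N) is an A-bimodule; [hDN] and [hDNr] say
   that the columns of DN generate it on the left and on the right. The quotient
   in the conclusion uses the right span of DN, and [hDN] does not imply [hDNr]. *)
Theorem theorem13
  (R A : nzRingType) (iota : {rmorphism R -> A}) (n : nat) (x : 'I_n -> A)
  (hA : bijective_skew_PBW iota x)
  (hAl : noetherian A) (hAr : noetherian A^c)
  (m s : nat) (f : 'I_s -> 'cV[A]_m)
  (l t : nat) (g : 'I_t -> 'cV[A]_l)
  (hg : forall j : 'I_t, g j \in central_in (bispan g))
  (s1 t1 : nat) (DM : 'M[A]_(s, s1)) (DN : 'M[A]_(t, t1))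
  (hDM : syz f =i lcolspan DM)
  (hDN : syz g =i lcolspan DN)
  (hDNr : syz g =i rcolspan DN)
  (q : nat) (G : 'M[A]_(s * t + s1 * t1, q))
  (hG : syzr (row_mx (DM *t (1%:M : 'M[A]_t))^T ((1%:M : 'M[A]_s1) *t DN))
          =i rcolspan G) :
  let U : 'M[A]_(s * t, q) := usubmx G in
  let W : 'M[A]_(s * t, s * t1) := (1%:M : 'M[A]_s) *t DN in
  [/\ {subset rcolspan W <= rcolspan U},
      lmod_iso (K := A^c) (homlr (submod f) g) (subquo (rcols U) (rcols W))
    & forall (p r : nat) (D : 'M[A]_(p, r)),
        is_presentation D (subquo (rcols U) (rcols W)) ->
        is_presentation D (homlr (submod f) g)].
Proof.
move=> U W.
have UP (a : 'cV[A]_(s * t)) :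
    a \in rcolspan U <-> exists h, represents (f := f) (g := g) a h.
  by rewrite (rcolspan_usubmx _ hG) (represents_coef hg hDM hDNr).
have iso : lmod_iso (K := A^c) (homlr (submod f) g) (subquo (rcols U) (rcols W)).
  refine (@lmod_iso_rel A^c (submod (rcols U)) (homlr (submod f) g)
    (restr_span (rcols W)) (fun v h => represents (f := f) (g := g) (val v) h) _ _ _ _ _).
  - by move=> c v v' h h'; apply: represents_linear.
  - by move=> v; apply/UP; apply: (valP v).
  - move=> h; have [a ha] := represents_ex hg h.
    have Ua : a \in rcolspan U by apply/UP; exists h.
    by exists (Submod Ua).
  - by move=> v; apply: represents0.
  - by move=> v h h'; apply: represents_inj.
split=> // [a | p r D presD].
  (* Elements of the span of [W] represent the zero map, hence lie in the span of [U]; so [subquo]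
     is the genuine quotient of the two spans. *)
  by move=> /(represents0 f hDNr) Wa; apply/UP; exists 0.
exact/(lmod_iso_trans presD)/lmod_iso_sym.
Qed.
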